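(* Suppose $P$ and $Q$ are finite $\mathrm{TN}$-posets such that $P$ has a largest element $\hat 1$ and $Q$ has a least element $\hat 0$. Then $P\oplus Q$, $(P\setminus\{\hat 1\})\oplus Q$ and $(P\setminus\{\hat 1\})\oplus(Q\setminus\{\hat 0\})$ are $\mathrm{TN}$-posets.
   Context: If $P=(X,\le_P)$ and $Q=(Y,\le_Q)$ are posets on disjoint sets $X$ and $Y$, the ordinal sum $P\oplus Q=(X\cup Y,\le)$ is the poset in which $z\le w$ if and only if $z\le_P w$, or $z\le_Q w$, or $z\in X$ and $w\in Y$. Let $P$ be a locally finite poset with a least element $\hat 0$. The quasi-rank function is $\rho:P\to\mathbb{N}$, $\rho(x)=\max\{k:\hat 0=x_0<x_1<\cdots<x_k=x\}$, and the quasi-rank of $P$ is $\rho(P)=\sup\{\rho(x):x\in P\}$. $P$ is quasi-rank uniform if for all $x,y\in P$ with $\rho(x)=\rho(y)$ and each $0\le k\le\rho(x)$, $|\{z\in[\hat 0,x]:\rho(z)=k\}|=|\{z\in[\hat 0,y]:\rho(z)=k\}|$. For a quasi-rank uniform poset $P$, let $r_{n,k}=|\{z\in[\hat 0,x]:\rho(z)=k\}|$ for any $x\in P$ with $\rho(x)=n$ and $0\le k\le n$, and $r_{n,k}=0$ for $k>n$; let $R(P)=(r_{n,k})_{n,k=0}^N$ with $N=\rho(P)$. A $\mathrm{TN}$-poset is a quasi-rank uniform poset $P$ such that $R(P)$ is totally nonnegative, that is, all minors of $R(P)$ are nonnegative.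
   Formalization: The claim for (P∖{1̂})⊕(Q∖{0̂}) is stated under the condition that P has more than one element or Q∖{0̂} has a least element; otherwise this sum has no least element (e.g. P={1̂}, Q={0<a, 0<b}) and is not a TN-poset. *)

(* Defs.v *)
From HB Require Import structures.
From mathcomp Require Import all_boot all_order all_algebra.

Set Implicit Arguments.
Unset Strict Implicit.
Unset Printing Implicit Defensive.

Import Order.TTheory GRing.Theory Num.Theory.
Local Open Scope order_scope.

(* The carrier of the ordinal sum is the disjoint union P + Q; it is given an
   alias so that no order is attached to the bare sum type. *)
Definition osum d1 d2 (P : porderType d1) (Q : porderType d2) : Type :=
  (P + Q)%type.

Section OrdinalSum.
Context {d1 d2 : Order.disp_t}.

HB.instance Definition _ (P : porderType d1) (Q : porderType d2) :=
  Choice.copy (osum P Q) (P + Q)%type.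

Definition osum_le (P : porderType d1) (Q : porderType d2) : rel (osum P Q) :=
  fun z w => match z, w with
  | inl x, inl y => x <= y
  | inr x, inr y => x <= y
  | inl _, inr _ => true
  | inr _, inl _ => false
  end.

Fact osum_le_refl (P : porderType d1) (Q : porderType d2) :
  reflexive (@osum_le P Q).
Proof. by case=> x /=. Qed.

Fact osum_le_anti (P : porderType d1) (Q : porderType d2) :
  antisymmetric (@osum_le P Q).
Proof. by case=> x [] y //= /le_anti ->. Qed.

Fact osum_le_trans (P : porderType d1) (Q : porderType d2) :
  transitive (@osum_le P Q).
Proof. by case=> y [] x [] z //=; apply: le_trans. Qed.

Fact osum_display : Order.disp_t. Proof. exact: Order.Disp tt tt. Qed.

HB.instance Definition _ (P : porderType d1) (Q : porderType d2) :=
  Order.Le_isPOrder.Build osum_display (osum P Q)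
    (@osum_le_refl P Q) (@osum_le_anti P Q) (@osum_le_trans P Q).

HB.instance Definition _ (P : finPOrderType d1) (Q : finPOrderType d2) :=
  Finite.copy (osum P Q) (P + Q)%type.

End OrdinalSum.

(* The induced order on P \ {a}. *)
Definition pdel d (P : porderType d) (a : P) : Type := {x : P | x != a}.

Section Deletion.
Context {d : Order.disp_t}.

HB.instance Definition _ (P : porderType d) (a : P) :=
  SubChoice.copy (pdel a) {x : P | x != a}.
HB.instance Definition _ (P : porderType d) (a : P) :=
  [SubChoice_isSubPOrder of pdel a by <: with d].
HB.instance Definition _ (P : finPOrderType d) (a : P) :=
  Finite.copy (pdel a) {x : P | x != a}.

End Deletion.

Definition is_least d (P : porderType d) (b : P) : Prop := forall x, b <= x.

(* b plays the role of the least element. A chain has at most #|P| elements,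
   so bounding the number k of steps by #|P| loses nothing. *)
Definition quasi_rank d (P : finPOrderType d) (b x : P) : nat :=
  (\max_(k < #|P| | [exists c : k.-tuple P,
                       path <%O b c && (last b c == x)]) k)%N.

Definition poset_quasi_rank d (P : finPOrderType d) (b : P) : nat :=
  (\max_(x : P) quasi_rank b x)%N.

Definition level_count d (P : finPOrderType d) (b x : P) (k : nat) : nat :=
  #|[set z : P | (b <= z <= x) && (quasi_rank b z == k)]|.

Definition quasi_rank_uniform d (P : finPOrderType d) (b : P) : Prop :=
  forall x y : P, quasi_rank b x = quasi_rank b y ->
  forall k : nat, (k <= quasi_rank b x)%N ->
  level_count b x k = level_count b y k.

(* An element of quasi-rank n exists for every n <= poset_quasi_rank b, and
   under quasi-rank uniformity the value does not depend on the one picked. *)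
Definition rank_coef d (P : finPOrderType d) (b : P) (n k : nat) : nat :=
  if (k <= n)%N then
    if [pick x : P | quasi_rank b x == n] is Some x then level_count b x k
    else 0%N
  else 0%N.

Definition rank_matrix d (P : finPOrderType d) (b : P) :
    'M[int]_((poset_quasi_rank b).+1) :=
  \matrix_(n, k) ((rank_coef b n k)%:R)%R.

Definition totally_nonnegative (R : numDomainType) m n (A : 'M[R]_(m, n)) :
    Prop :=
  forall (k : nat) (f : 'I_k -> 'I_m) (g : 'I_k -> 'I_n),
    {homo f : i j / (i < j)%N} -> {homo g : i j / (i < j)%N} ->
    (0 <= \det (mxsub f g A))%R.

Definition TN_poset d (P : finPOrderType d) : Prop :=
  exists b : P, [/\ is_least b, quasi_rank_uniform b
                  & totally_nonnegative (rank_matrix b)].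

(* Main.v *)
Require Import Defs.
From mathcomp Require Import all_boot all_order all_algebra.
From mathcomp Require Import perm zify.

Set Implicit Arguments.
Unset Strict Implicit.
Unset Printing Implicit Defensive.

Import Order.TTheory GRing.Theory Num.Theory.
Local Open Scope ring_scope.

(** Let c be the rank of the largest element of P, and let A and B be the rank
    matrices of P and Q. Both are lower triangular, A has 1 in its last
    diagonal position (c, c), and the first column of B consists of ones. In
    P minus its largest element, followed by Q, an element of Q of rank n in Q
    has rank c + n. Below it lies all of P without its top, whose level sizes
    are the entries of the last row of A, and then its ideal in Q, counted by
    row n of B. So the rank matrix of this poset superposes A and B in one
    diagonal entry, and it is the product

      (I + B) (A + I)

    of two direct sums with identity blocks whose blocks A and B overlap in
    index c: multiplying the last row of A by the first column of B copies
    that row into all rows of B. Direct sums with an identity are totally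
    nonnegative by Laplace expansion, and products of totally nonnegative
    matrices are so by the Cauchy-Binet formula (tn_array_mul); this gives
    tn_array_glue.

    The other two posets reduce to this one. The sum of P and Q is the same
    construction for P with a new largest element, whose matrix arises from A
    by duplicating the last row and appending a 1 (tn_array_extend). Deleting
    the least element of Q deletes row and column c from the glued matrix.

    On the side of posets, the quasi-rank is characterized as the only strictly
    increasing function for which every element of positive rank n + 1 lies
    above one of rank n (ranking_unique). It thus suffices to exhibit such a
    function on the ordinal sum and to count (TN_poset_of_rank_array). *)

(** * Products of totally nonnegative arrays *)

(** A form of the Cauchy-Binet formula in which the sum runs over all maps
    instead of the increasing ones; each set of columns is then counted once
    per ordering, whence the factorial. No transversal of the orderings has to
    be chosen: each permutation only relabels the sum over all maps. *)
Lemma fact_det_mulmx (R : comPzRingType) k n (A : 'M[R]_(k, n))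
    (B : 'M[R]_(n, k)) :
  \det (A *m B) *+ k`! =
    \sum_(h : {ffun 'I_k -> 'I_n}) \det (colsub h A) * \det (rowsub h B).
Proof.
have detE : \det (A *m B) =
    \sum_(h : {ffun 'I_k -> 'I_n}) \prod_i A i (h i) * \det (rowsub h B).
  transitivity (\sum_(h : {ffun 'I_k -> 'I_n}) \sum_(s : 'S_k)
      (-1) ^+ s * \prod_i (A i (h i) * B (h i) (s i))).
    rewrite exchange_big; apply: eq_bigr => /= s _; rewrite -big_distrr /=.
    congr (_ * _); rewrite -(bigA_distr_bigA (fun i j => A i j * B j (s i))) /=.
    by apply: eq_bigr => i _; rewrite mxE.
  apply: eq_bigr => h _; rewrite big_distrr; apply: eq_bigr => s _ /=.
  rewrite mulrCA big_split; congr (_ * (_ * _)).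
  by apply: eq_bigr => i _; rewrite mxE.
(* By reindexing, the sum over h of F s h is \det (A *m B) for every s. *)
pose F (s : 'S_k) (h : {ffun 'I_k -> 'I_n}) :=
  (-1) ^+ s * \prod_i A i (h (s i)) * \det (rowsub h B).
transitivity (\sum_(h : {ffun 'I_k -> 'I_n}) \sum_(s : 'S_k) F s h); last first.
  apply: eq_bigr => h _; rewrite -mulr_suml; congr (_ * _).
  apply: eq_bigr => s _; congr (_ * _); apply: eq_bigr => i _.
  by rewrite mxE.
rewrite exchange_big /=.
rewrite (eq_bigr (fun=> \det (A *m B))) => [|s _].
  by rewrite sumr_const -card_Sn; congr (_ *+ _).
rewrite detE.
pose F' (h : {ffun 'I_k -> 'I_n}) := [ffun i => h (s^-1%g i)].
rewrite (reindex F') /=; last first.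
  exists (fun h => [ffun i => h (s i)]) => h _; apply/ffunP=> i; rewrite !ffunE.
    by rewrite permK.
  by rewrite permKV.
apply: eq_bigr => h _; rewrite /F /F'.
have -> : rowsub [ffun i => h (s^-1%g i)] B = row_perm s^-1%g (rowsub h B).
  by apply/matrixP=> i j; rewrite !mxE ffunE.
rewrite row_permE det_mulmx det_perm odd_permV mulrACA -signr_addb addbb mul1r.
by congr (_ * _); apply: eq_bigr => i _; rewrite ffunE permK.
Qed.

Lemma injective_sort_perm k (h : 'I_k -> nat) : injective h ->
  exists s : 'S_k, {homo h \o s : i j / (i < j)%N}.
Proof.
move=> h_inj; pose t := [tuple h i | i < k].
have /tuple_permP[s es] : perm_eq (sort leq t) t by rewrite perm_sort.
exists s => i j ltij /=.
have /= nthE (l : 'I_k) : nth 0%N (sort leq t) l = h (s l).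
  by rewrite es -[l in nth _ _ l]/(val l) -tnth_nth !tnth_mktuple.
have t_uniq : uniq t by rewrite map_inj_uniq ?enum_uniq.
have t_sorted : sorted ltn (sort leq t).
  by rewrite ltn_sorted_uniq_leq sort_uniq t_uniq sort_sorted.
rewrite -!nthE;
  apply: (sorted_ltn_nth ltn_trans) => //;
  by rewrite inE size_sort size_tuple card_ord ltn_ord.
Qed.

(** Total nonnegativity for arrays indexed by all natural numbers: a matrix is
    seen as such an array by padding it with zeros, so that matrices of
    different sizes compose without any cast between ordinals. *)
Definition tn_array (R : numDomainType) (a : nat -> nat -> R) : Prop :=
  forall k (f g : 'I_k -> nat),
    {homo f : i j / (i < j)%N} -> {homo g : i j / (i < j)%N} ->
    0 <= \det (\matrix_(i, j) a (f i) (g j)).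

Lemma tn_array_comp (R : numDomainType) (a : nat -> nat -> R) u v :
  {homo u : n m / (n < m)%N} -> {homo v : n m / (n < m)%N} ->
  tn_array a -> tn_array (fun n k => a (u n) (v k)).
Proof.
move=> hu hv ta k f g hf hg.
by apply: (ta k (u \o f) (v \o g)) => i j ltij /=; [apply/hu/hf | apply/hv/hg].
Qed.

(** Duplicating a row: a minor that uses both copies has two equal rows. *)
Lemma tn_array_unbump (R : numDomainType) (a : nat -> nat -> R) h :
  tn_array a -> tn_array (fun n k => a (unbump h n) k).
Proof.
move=> ta k f g hf hg.
case: (boolP [exists i : 'I_k, exists j : 'I_k,
           (i < j)%N && (unbump h (f i) == unbump h (f j))]).
  case/existsP=> i /existsP[j /andP[ltij /eqP eij]].
  rewrite (@determinant_alternate _ _ _ i j) //; first by rewrite neq_ltn ltij.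
  by move=> l; rewrite !mxE eij.
rewrite negb_exists => /forallP neq_uf.
apply: (ta k (unbump h \o f) g) => // i j ltij /=.
have := neq_uf i; rewrite negb_exists => /forallP/(_ j); rewrite ltij /=.
have := hf _ _ ltij; rewrite /unbump.
by case: (ltnP h (f i)); case: (ltnP h (f j)) => /=; lia.
Qed.

(** In the Cauchy-Binet sum a map that is not injective contributes 0; any
    other one is sorted by a permutation, whose sign appears in both factors
    and cancels, leaving a product of two increasing minors. *)
Lemma tn_array_mul (R : numDomainType) (a b : nat -> nat -> R) n :
  tn_array a -> tn_array b ->
  tn_array (fun i k => \sum_(j < n) a i j * b j k).
Proof.
move=> ta tb k f g hf hg.
pose A := \matrix_(i < k, j < n) a (f i) j.
pose B := \matrix_(j < n, i < k) b j (g i).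
have -> : \matrix_(i, j) (\sum_(l < n) a (f i) l * b l (g j)) = A *m B.
  by apply/matrixP=> i j; rewrite !mxE; apply: eq_bigr => l _; rewrite !mxE.
have /(pmulrn_lge0 (\det (A *m B))) <- : (0 < k`!)%N by rewrite fact_gt0.
rewrite fact_det_mulmx; apply: sumr_ge0 => h _.
have [h_inj|/injectivePn[i [j neqij eqh]]] := altP (injectiveP h); last first.
  rewrite [\det (rowsub h B)](determinant_alternate neqij) ?mulr0 //.
  by move=> l; rewrite !mxE eqh.
have [s hs] := injective_sort_perm (inj_comp val_inj h_inj).
have -> : \det (colsub h A) = (-1) ^+ s * \det (colsub (h \o s) A).
  rewrite -[colsub h A]trmxK det_tr -[colsub (h \o s) A]trmxK [in RHS]det_tr.
  have -> : (colsub (h \o s) A)^T = row_perm s (colsub h A)^T.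
    by apply/matrixP=> i j; rewrite !mxE.
  by rewrite row_permE det_mulmx det_perm signrMK.
have -> : \det (rowsub h B) = (-1) ^+ s * \det (rowsub (h \o s) B).
  have -> : rowsub (h \o s) B = row_perm s (rowsub h B).
    by apply/matrixP=> i j; rewrite !mxE.
  by rewrite row_permE det_mulmx det_perm signrMK.
rewrite mulrACA -signr_addb addbb mul1r; apply: mulr_ge0.
  have -> : colsub (h \o s) A = \matrix_(i, j) a (f i) (h (s j)).
    by apply/matrixP=> i j; rewrite !mxE.
  exact: ta.
have -> : rowsub (h \o s) B = \matrix_(i, j) b (h (s i)) (g j).
  by apply/matrixP=> i j; rewrite !mxE.
exact: tb.
Qed.

(** * Direct sums with an identity block, and gluing *)

Lemma det_row0 (R : comPzRingType) n (A : 'M[R]_n) i :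
  (forall j, A i j = 0) -> \det A = 0.
Proof.
by move=> A0; rewrite (expand_det_row _ i) big1 // => j _; rewrite A0 mul0r.
Qed.

Lemma det_col0 (R : comPzRingType) n (A : 'M[R]_n) j :
  (forall i, A i j = 0) -> \det A = 0.
Proof.
by move=> A0; rewrite (expand_det_col _ j) big1 // => i _; rewrite A0 mul0r.
Qed.

(** The direct sum of an identity block of size c and b. *)
Definition array_prepend (R : numDomainType) c (b : nat -> nat -> R) n k : R :=
  if (n < c)%N then (n == k)%:R
  else if (k < c)%N then 0 else b (n - c)%N (k - c)%N.

(** A minor that contains the corner is, by expansion along its first row, a
    minor of b; one that meets only the new row or only the new column
    vanishes. *)
Lemma tn_array_prepend1 (R : numDomainType) (b : nat -> nat -> R) :
  tn_array b -> tn_array (array_prepend 1 b).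
Proof.
move=> tb [|k] f g hf hg; first by rewrite det_mx00.
have pos (u : 'I_k.+1 -> nat) (j : 'I_k.+1) : {homo u : i j / (i < j)%N} ->
    (0 < j)%N || (0 < u ord0)%N -> (0 < u j)%N.
  move=> hu; case: (posnP j) => [j0|lt0j _].
    by rewrite (_ : j = ord0) //; apply: val_inj.
  exact: leq_ltn_trans (leq0n _) (hu ord0 j lt0j).
have lift_pos (u : 'I_k.+1 -> nat) i : {homo u : i j / (i < j)%N} ->
    (0 < u (lift ord0 i))%N by move=> hu; apply: pos; rewrite ?lift0.
have pred_homo m (v : 'I_m -> nat) : {homo v : i j / (i < j)%N} ->
    (forall i, 0 < v i)%N -> {homo (fun i => (v i).-1) : i j / (i < j)%N}.
  by move=> hv v0 i j ltij; have := hv _ _ ltij; have := v0 i; lia.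
have shift (u : 'I_k.+1 -> nat) : {homo u : i j / (i < j)%N} ->
    {homo (fun i : 'I_k => (u (lift ord0 i)).-1) : i j / (i < j)%N}.
  move=> hu; apply: (pred_homo _ (u \o lift ord0)) => [i j ltij|i] /=.
    by apply: hu; rewrite !lift0.
  exact: lift_pos.
have prependS n m : (0 < n)%N -> (0 < m)%N ->
    array_prepend 1 b n m = b n.-1 m.-1 
  by case: n m => [|n] [|m] _ _ //; rewrite /array_prepend !subn1.
case: (posnP (f ord0)) => f0; case: (posnP (g ord0)) => g0.
- rewrite (expand_det_row _ ord0) big_ord_recl big1 => [|i _]; last first.
    have := lift_pos g i hg; rewrite !mxE f0 /array_prepend /=.
    by case: (g _) => // ? _; rewrite mul0r.
  rewrite !mxE f0 g0 mul1r addr0 /cofactor mul1r.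
  have := tb k _ _ (shift f hf) (shift g hg); congr (0 <= \det _).
  by apply/matrixP=> i j; rewrite !mxE prependS // lift_pos.
- rewrite (@det_row0 _ _ _ ord0) // => j; rewrite mxE f0 /array_prepend /=.
  by have := pos g j hg; rewrite g0 orbT => /(_ isT); case: (g j).
- rewrite (@det_col0 _ _ _ ord0) // => j; rewrite mxE g0 /array_prepend.
  by have := pos f j hf; rewrite f0 orbT => /(_ isT); case: (f j).
have fp i : (0 < f i)%N by apply: pos; rewrite ?f0 ?orbT.
have gp i : (0 < g i)%N by apply: pos; rewrite ?g0 ?orbT.
have := tb _ _ _ (pred_homo _ f hf fp) (pred_homo _ g hg gp).
congr (0 <= \det _).
by apply/matrixP=> i j; rewrite !mxE prependS.
Qed.

Lemma eq_tn_array (R : numDomainType) (a b : nat -> nat -> R) :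
  (forall n k, a n k = b n k) -> tn_array a -> tn_array b.
Proof.
move=> eqab ta k f g hf hg; have := ta k f g hf hg; congr (0 <= \det _).
by apply/matrixP=> i j; rewrite !mxE.
Qed.

Lemma tn_array_prepend (R : numDomainType) c (b : nat -> nat -> R) :
  tn_array b -> tn_array (array_prepend c b).
Proof.
move=> tb; elim: c => [|c IHc].
  by apply: eq_tn_array tb => n k; rewrite /array_prepend !subn0.
apply: eq_tn_array (tn_array_prepend1 IHc) => -[|n] [|k] //.
  by rewrite /array_prepend /=; case: ifP.
by rewrite /array_prepend !ltnS !ltn0 !subn1 !subSS eqSS.
Qed.

(** Adds an identity block of size N at the diagonal position (c, c). *)
Definition array_append (R : numDomainType) c N (a : nat -> nat -> R) n k : R :=
  a n k + ((n == k) && (c <= n < c + N)%N)%:R.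

(** Induction on the size of the block. A minor that ends in the last column of
    the block has there at most one nonzero entry. Unless that entry lies in
    its last row, the minor vanishes; otherwise expanding along the column
    leaves a minor for a smaller block. *)
Lemma tn_array_append (R : numDomainType) c N (a : nat -> nat -> R) :
  (forall n k, (c < n)%N -> a n k = 0) ->
  (forall n k, (c <= k)%N -> a n k = 0) ->
  tn_array a -> tn_array (array_append c N a).
Proof.
move=> a_row a_col ta; elim: N => [|N IHN].
  apply: eq_tn_array ta => n k; rewrite /array_append.
  by rewrite (_ : _ && _ = false) ?addr0 //; lia.
move=> [|k] f g hf hg; first by rewrite det_mx00.
have lt_max (u : 'I_k.+1 -> nat) i : {homo u : i j / (i < j)%N} ->
    i != ord_max -> (u i < u ord_max)%N.
  move=> hu ni; apply: hu; have := ltn_ord i; move: ni.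
  by rewrite -val_eqE /=; lia.
have le_max (u : 'I_k.+1 -> nat) i : {homo u : i j / (i < j)%N} ->
    (u i <= u ord_max)%N.
  by move=> hu; case: (eqVneq i ord_max) => [->|/(lt_max u i hu)/ltnW].
case: (ltngtP (g ord_max) (c + N)) => [ltg|gtg|eqg].
- have := IHN _ f g hf hg; congr (0 <= \det _).
  apply/matrixP=> i j; rewrite !mxE /array_append; congr (_ + _%:R).
  by have := le_max g j hg; lia.
- rewrite (@det_col0 _ _ _ ord_max) // => i; rewrite mxE /array_append.
  rewrite a_col; last by lia.
  by rewrite (_ : _ && _ = false) ?addr0 //; lia.
(* From here on the minor ends in the last column of the block. *)
have colE i : array_append c N.+1 a (f i) (g ord_max) = (f i == (c + N)%N)%:R.
  by rewrite /array_append eqg a_col ?add0r; [congr (_%:R)|]; lia.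
have [/eqP eqf|neqf] := boolP (f ord_max == (c + N)%N); last first.
  case: (ltngtP (f ord_max) (c + N)) neqf => // [ltf|gtf] _.
    rewrite (@det_col0 _ _ _ ord_max) // => i; rewrite mxE colE.
    by have := le_max f i hf; case: eqP => //; lia.
  rewrite (@det_row0 _ _ _ ord_max) // => j; rewrite mxE /array_append.
  rewrite a_row; last by lia.
  by rewrite (_ : _ && _ = false) ?addr0 //; lia.
rewrite (expand_det_col _ ord_max) big_ord_recr big1 => [|i _]; last first.
  have ni : widen_ord (leqnSn k) i != ord_max.
    by rewrite -val_eqE /= neq_ltn ltn_ord.
  rewrite mxE colE; have := lt_max f _ hf ni; rewrite eqf.
  by case: eqP => [->|]; rewrite ?ltnn ?mul0r.
rewrite /= mxE colE eqf eqxx mul1r add0r /cofactor.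
rewrite addnn -signr_odd odd_double mul1r.
have homo_lift (u : 'I_k.+1 -> nat) : {homo u : i j / (i < j)%N} ->
    {homo u \o lift ord_max : i j / (i < j)%N}.
  by move=> hu i j ltij /=; apply: hu; rewrite !lift_max.
have := IHN _ _ _ (homo_lift f hf) (homo_lift g hg); congr (0 <= \det _).
apply/matrixP=> i j; rewrite !mxE /array_append /=; congr (_ + _%:R).
have := lt_max g (lift ord_max j) hg.
by rewrite eqg eq_sym neq_lift => /(_ isT); lia.
Qed.

(** The matrix obtained from a (rows and columns up to c) and b by superposing
    the last diagonal entry of a with the first diagonal entry of b; below a, the
    last row of a is scaled by the first column of b. *)
Definition array_glue (R : numDomainType) c (a b : nat -> nat -> R) n k : R :=
  if (n < c)%N then a n k
  else if (k < c)%N then a c k * b (n - c)%N 0%N else b (n - c)%N (k - c)%N.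

(** The glued matrix is the product of the direct sums I + b and a + I, whose
    blocks a and b share the single index c. The bound N makes the product a
    finite sum. *)
Lemma tn_array_glue (R : numDomainType) c N (a b : nat -> nat -> R) :
  (forall n k, (c < n)%N -> a n k = 0) ->
  (forall n k, (n < k)%N -> a n k = 0) ->
  a c c = 1 -> (forall n k, (N < k)%N -> b n k = 0) ->
  tn_array a -> tn_array b -> tn_array (array_glue c a b).
Proof.
move=> a_row a_tri acc b_col ta tb.
have tapp : tn_array (array_append c.+1 N a).
  apply: tn_array_append => // n k ltc; first by apply: a_row; lia.
  by case: (ltnP c n) => [/a_row->//|lenc]; apply: a_tri; lia.
apply: eq_tn_array (tn_array_mul (c + N).+1 (tn_array_prepend c tb) tapp).
move=> n k; rewrite /array_glue /array_prepend.
case: (ltnP n c) => [ltnc|lecn].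
  have lt : (n < (c + N).+1)%N by lia.
  rewrite (bigD1 (Ordinal lt)) //= big1 => [|j].
    rewrite eqxx mul1r addr0 /array_append (_ : (c < n < _)%N = false).
      by rewrite andbF addr0.
    lia.
  by rewrite -val_eqE /= eq_sym => /negPf->; rewrite mul0r.
(* In the columns from c on, the rows from c on of the right factor are those
   of the identity up to c + N: a is lower triangular with a c c = 1. *)
have app_ge j : (c <= j)%N -> (c <= k)%N -> 
    array_append c.+1 N a j k = ((j == k) && (k <= c + N)%N)%:R.
  move=> lecj leck; rewrite /array_append.
  case: (ltngtP c j) lecj => // [ltcj|<-] _.
    by rewrite a_row // add0r; congr (_%:R); lia.
  rewrite (_ : _ && _ = false) ?addr0; last by lia.
  case: (ltngtP c k) leck => // [ltck|<-] _; first by rewrite a_tri.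
  by rewrite acc leq_addr.
have app_lt j : (c < j)%N -> (k < c)%N -> array_append c.+1 N a j k = 0.
  move=> ltcj ltkc; rewrite /array_append a_row // (_ : _ && _ = false).
    by rewrite addr0.
  lia.
case: (ltnP k c) => [ltkc|leck].
  have lt : (c < (c + N).+1)%N by lia.
  rewrite (bigD1 (Ordinal lt)) //= big1 => [|j].
    by rewrite ltnn subnn addr0 mulrC /array_append ltnn andbF addr0.
  rewrite -val_eqE /= => neq.
  case: (ltnP j c) => [|lecj]; first by rewrite mul0r.
  by rewrite app_lt ?mulr0 //; lia.
case: (leqP k (c + N)) => [lekN|ltNk].
  have lt : (k < (c + N).+1)%N by lia.
  rewrite (bigD1 (Ordinal lt)) //= big1 => [|j].
    by rewrite ltnNge leck /= app_ge // eqxx lekN mulr1 addr0.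
  rewrite -val_eqE /= => /negPf neq.
  case: (ltnP j c) => [|lecj]; first by rewrite mul0r.
  by rewrite app_ge // neq mulr0.
rewrite b_col; last by lia.
rewrite big1 // => j _; case: (ltnP j c) => [|lecj]; first by rewrite mul0r.
by rewrite app_ge // (leqNgt k) ltNk andbF mulr0.
Qed.

(** The array of the poset obtained by adding a new largest element to a poset
    with a largest element of rank c. *)
Definition array_extend (R : numDomainType) c (a : nat -> nat -> R) n k : R :=
  if n == c.+1 then a c k + (k == c.+1)%:R else a n k.

(** Duplicate row c, then append a 1 in the corner. *)
Lemma tn_array_extend (R : numDomainType) c (a : nat -> nat -> R) :
  (forall n k, (c < n)%N -> a n k = 0) ->
  (forall n k, (n < k)%N -> a n k = 0) ->
  tn_array a -> tn_array (array_extend c a).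
Proof.
move=> a_row a_tri ta.
have a_col n k : (c < k)%N -> a n k = 0.
  by case: (ltnP c n) => [/a_row->//|lenc ltck]; apply: a_tri; lia.
have := @tn_array_append _ c.+1 1 _ _ _ (tn_array_unbump c ta).
have unbumpS n : (c < n)%N -> unbump c n = n.-1.
  by rewrite /unbump => ->; rewrite subn1.
have unbump_id n : (n <= c)%N -> unbump c n = n.
  by rewrite /unbump ltnNge => ->; rewrite subn0.
move=> H; apply: eq_tn_array (H _ _) => [n k|n k ltcn|n k ltck]; last 2 first.
- by rewrite unbumpS ?a_row //; lia.
- exact: a_col.
rewrite /array_append /array_extend; case: (ltngtP n c.+1) => [ltn|gtn|->].
- by rewrite unbump_id // andbF addr0.
- rewrite unbumpS ?a_row; try lia.
  by rewrite [(n < _)%N]ltnNge addn1 gtn /= andbF addr0.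
- by rewrite unbumpS //= eq_sym addn1 ltnSn andbT.
Qed.

(** * Rankings and rank arrays of posets *)

(** An intrinsic description of the length of the longest chain below x; it
    mentions no least element, so that it survives the deletion of one. *)
Definition ranking d (P : porderType d) (r : P -> nat) : Prop :=
  (forall x y, (x < y)%O -> (r x < r y)%N) /\
  (forall x, (0 < r x)%N -> exists2 y, (y < x)%O & r x = (r y).+1).

Lemma leq_ranking d (P : porderType d) (r s : P -> nat) x :
  ranking r -> ranking s -> (r x <= s x)%N.
Proof.
move=> [_ r_pred] [s_homo _].
have [n] := ubnP (r x); elim: n x => // n IHn x lt_rx.
case: (posnP (r x)) => [->//|/r_pred[y ltyx rxE]].
by rewrite rxE (leq_ltn_trans _ (s_homo _ _ ltyx)) // IHn // -ltnS -rxE.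
Qed.

Lemma ranking_unique d (P : porderType d) (r s : P -> nat) :
  ranking r -> ranking s -> r =1 s.
Proof. by move=> rr rs x; apply/eqP; rewrite eqn_leq !leq_ranking. Qed.

Lemma ranking_onto d (P : porderType d) (r : P -> nat) x n :
  ranking r -> (n <= r x)%N -> exists y, r y = n.
Proof.
move=> [_ r_pred]; have [m] := ubnP (r x); elim: m x => // m IHm x lt_rx.
rewrite leq_eqVlt => /orP[/eqP->|ltn]; first by exists x.
have /r_pred[y _ rxE] : (0 < r x)%N by lia.
by apply: (IHm y); lia.
Qed.

Lemma leq_quasi_rank d (P : finPOrderType d) (b : P) (c : seq P) :
  path <%O b c -> (size c <= quasi_rank b (last b c))%N.
Proof.
move=> bc.
have /card_uniqP/= cardE := lt_sorted_uniq (bc : sorted <%O (b :: c)).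
have lt_size : (size c < #|P|)%N by rewrite -cardE max_card.
apply: (@leq_bigmax_cond _ _ (fun k : 'I__ => k : nat) (Ordinal lt_size)).
by apply/existsP; exists (in_tuple c); rewrite bc eqxx.
Qed.

Lemma quasi_rank_chain d (P : finPOrderType d) (b x : P) : is_least b ->
  exists2 c, path <%O b c & last b c = x /\ size c = quasi_rank b x.
Proof.
move=> b_least.
pose C := [pred k : 'I_#|P| |
  [exists c : k.-tuple P, path <%O b c && (last b c == x)]].
have C_gt0 : (0 < #|C|)%N.
  apply/card_gt0P; case: (eqVneq x b) => [eqxb|nxb].
    have lt : (0 < #|P|)%N by apply/card_gt0P; exists b.
    by exists (Ordinal lt); apply/existsP; exists [tuple]; rewrite /= eqxb.
  have lt : (1 < #|P|)%N by apply/card_gt1P; exists x, b.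
  exists (Ordinal lt); apply/existsP; exists [tuple x] => /=.
  by rewrite eqxx !andbT lt_neqAle eq_sym nxb b_least.
have [k /existsP[c /andP[bc /eqP lastc]] rankE] :=
  eq_bigmax_cond (fun k : 'I__ => k : nat) C_gt0.
by exists c => //; rewrite size_tuple; split=> //; rewrite -rankE.
Qed.

Lemma ranking_quasi_rank d (P : finPOrderType d) (b : P) :
  is_least b -> ranking (quasi_rank b).
Proof.
move=> b_least.
have homo x y : (x < y)%O -> (quasi_rank b x < quasi_rank b y)%N.
  move=> ltxy; have [c bc [lastc <-]] := quasi_rank_chain x b_least.
  have := @leq_quasi_rank _ _ b (rcons c y).
  by rewrite rcons_path bc lastc ltxy last_rcons size_rcons; apply.
split=> // x; have [c bc [lastc rankE]] := quasi_rank_chain x b_least.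
case/lastP: c bc lastc rankE => [_ _ <- //|c y].
rewrite rcons_path last_rcons size_rcons => /andP[bc lty] eqyx rankE _.
subst y; exists (last b c) => //; apply/eqP.
by rewrite eqn_leq homo // andbT -rankE ltnS leq_quasi_rank.
Qed.

(** M holds the level counts of all principal ideals; that such an M exists is
    rank uniformity. *)
Definition rank_counts d (P : finPOrderType d) (r : P -> nat)
    (M : nat -> nat -> int) : Prop :=
  forall x k, #|[set z | (z <= x)%O && (r z == k)]|%:R = M (r x) k.

Lemma rank_counts0 d (P : finPOrderType d) (r : P -> nat) x k :
  ranking r -> (r x < k)%N -> #|[set z | (z <= x)%O && (r z == k)]| = 0%N.
Proof.
move=> [r_homo _] ltxk; apply/eqP; rewrite cards_eq0; apply/eqP/setP=> z.
rewrite !inE; apply/negP=> /andP[lezx /eqP rzE].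
move: lezx; rewrite le_eqVlt => /orP[/eqP eqzx|/r_homo]; last by lia.
by move: ltxk; rewrite -rzE eqzx ltnn.
Qed.

(** The quasi-rank is the only ranking, so any ranking whose level counts form a
    totally nonnegative array exhibits a TN-poset. *)
Lemma TN_poset_of_rank_array d (S : finPOrderType d) (b : S) (r : S -> nat) M :
  is_least b -> ranking r -> rank_counts r M -> tn_array M -> TN_poset S.
Proof.
move=> b_least rr rM tM.
have rE := ranking_unique (ranking_quasi_rank b_least) rr.
have countE x k : (level_count b x k)%:R = M (r x) k.
  rewrite -rM /level_count; congr (_%:R); apply: eq_card => z.
  by rewrite !inE b_least rE.
exists b; split=> //.
  move=> x y; rewrite !rE => eqr k _; apply/eqP.
  by rewrite -(eqr_nat int) !countE eqr.
have coefE n k : (n <= poset_quasi_rank b)%N -> (rank_coef b n k)%:R = M n k.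
  move=> len; have [x rx] : exists x, r x = n.
    have [|x _ maxE] := @eq_bigmax_cond _ predT (quasi_rank b).
      by apply/card_gt0P; exists b.
    by apply: (@ranking_onto _ _ _ x) => //; rewrite -rE -maxE.
  rewrite /rank_coef; case: (leqP k n) => [_|ltnk].
    case: pickP => [y /eqP|/(_ x)]; last by rewrite rE rx eqxx.
    by rewrite rE => ry; rewrite countE ry.
  by rewrite -rx -rM rank_counts0 // rx.
move=> k f g hf hg; have := tM k (fun i => f i) (fun i => g i) hf hg.
congr (0 <= \det _); apply/matrixP=> i j; rewrite !mxE coefE //.
by rewrite -ltnS ltn_ord.
Qed.

(** The converse: the rank matrix padded with zeros stays totally nonnegative,
    because a minor that leaves the matrix has a zero row or column. *)
Lemma TN_poset_rank_array d (S : finPOrderType d) : TN_poset S ->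
  exists (b : S) (r : S -> nat) M N,
    [/\ is_least b, ranking r, rank_counts r M, tn_array M &
      [/\ forall x, (r x <= N)%N, exists x, r x = N,
          forall n k, (N < n)%N -> M n k = 0
        & forall n k, (n < k)%N -> M n k = 0]].
Proof.
case=> b [b_least unif tn_R].
have rr := ranking_quasi_rank b_least.
pose N := poset_quasi_rank b.
have leN x : (quasi_rank b x <= N)%N by apply: leq_bigmax_cond.
pose M n k : int := (rank_coef b n k)%:R.
have M_row n k : (N < n)%N -> M n k = 0.
  move=> ltNn; rewrite /M /rank_coef; case: leqP => // _.
  by case: pickP => // x /eqP rx; have := leN x; lia.
have M_tri n k : (n < k)%N -> M n k = 0.
  by rewrite /M /rank_coef ltnNge => /negPf->.
exists b, (quasi_rank b), M, N; split=> //.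
- move=> x k; rewrite /M /rank_coef; case: leqP => [lek|ltk]; last first.
    by rewrite rank_counts0.
  case: pickP => [y /eqP ry|/(_ x)]; last by rewrite eqxx.
  rewrite (unif y x) ?ry //; congr (_%:R); apply: eq_card => z.
  by rewrite !inE b_least.
- move=> k f g hf hg.
  have [/existsP[i ltNf]|] := boolP [exists i, N < f i]%N.
    by rewrite (@det_row0 _ _ _ i) // => j; rewrite mxE M_row.
  rewrite negb_exists => /forallP leNf.
  have [/existsP[j ltNg]|] := boolP [exists j, N < g j]%N.
    rewrite (@det_col0 _ _ _ j) // => i; rewrite mxE M_tri //.
    by have := leNf i; lia.
  rewrite negb_exists => /forallP leNg.
  pose f' i : 'I_N.+1 := inord (f i); pose g' i : 'I_N.+1 := inord (g i).
  have fE i : f' i = f i :> nat.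
    by apply: inordK; rewrite ltnS leqNgt; apply: leNf.
  have gE i : g' i = g i :> nat.
    by apply: inordK; rewrite ltnS leqNgt; apply: leNg.
  have := tn_R k f' g'.
  have -> : \matrix_(i, j) M (f i) (g j) = mxsub f' g' (rank_matrix b).
    by apply/matrixP=> i j; rewrite !mxE fE gE.
  by apply=> i j ltij; rewrite ?fE ?gE; [apply: hf | apply: hg].
split=> //.
have [|x _ maxE] := @eq_bigmax_cond _ predT (quasi_rank b).
  by apply/card_gt0P; exists b.
by exists x; rewrite -maxE.
Qed.

(** * Ordinal sums and deletions *)

Definition osum_rank d1 d2 (P : porderType d1) (Q : porderType d2) c
    (r : P -> nat) (s : Q -> nat) (z : osum P Q) : nat :=
  match z with inl x => r x | inr y => (c + s y)%N end.

Lemma le_inl d1 d2 (P : porderType d1) (Q : porderType d2) (x y : P) :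
  ((inl x : osum P Q) <= inl y)%O = (x <= y)%O.
Proof. by []. Qed.

Lemma le_inr d1 d2 (P : porderType d1) (Q : porderType d2) (x y : Q) :
  ((inr x : osum P Q) <= inr y)%O = (x <= y)%O.
Proof. by []. Qed.

Lemma le_inlr d1 d2 (P : porderType d1) (Q : porderType d2) (x : P) (y : Q) :
  ((inl x : osum P Q) <= inr y)%O.
Proof. by []. Qed.

Lemma lt_inl d1 d2 (P : porderType d1) (Q : porderType d2) (x y : P) :
  ((inl x : osum P Q) < inl y)%O = (x < y)%O.
Proof. by rewrite !lt_def. Qed.

Lemma lt_inr d1 d2 (P : porderType d1) (Q : porderType d2) (x y : Q) :
  ((inr x : osum P Q) < inr y)%O = (x < y)%O.
Proof. by rewrite !lt_def. Qed.

(** A longest chain below an element of Q starts with a longest chain of P; the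
    last hypothesis, vacuous when c = 0, provides its step from P to Q. *)
Lemma ranking_osum d1 d2 (P : porderType d1) (Q : porderType d2) c
    (r : P -> nat) (s : Q -> nat) :
  ranking r -> ranking s -> (forall x, (r x < c)%N) ->
  ((0 < c)%N -> exists x, r x = c.-1) -> ranking (osum_rank c r s).
Proof.
move=> [r_homo r_pred] [s_homo s_pred] ltrc r_max; split.
  case=> [x|x] [y|y]; rewrite ?lt_inl ?lt_inr //=.
  - exact: r_homo.
  - by move=> _; apply: leq_trans (ltrc x) (leq_addr _ _).
  - by rewrite ltn_add2l; apply: s_homo.
case=> [x|y] /=.
  by case/r_pred=> y ltyx rE; exists (inl y); rewrite ?lt_inl.
case: (posnP (s y)) => [s0|/s_pred[z ltzy sE] _].
  rewrite s0 addn0 => c0; have [x rx] := r_max c0.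
  by exists (inl x) => //=; rewrite rx prednK.
by exists (inr z); rewrite ?lt_inr //= sE addnS.
Qed.

Lemma rank_counts_osum d1 d2 (P : finPOrderType d1) (Q : finPOrderType d2) c
    (r : P -> nat) (s : Q -> nat) (M : nat -> nat -> int) :
  (forall x, (r x < c)%N) ->
  rank_counts r M ->
  (forall y k, (k < c)%N -> #|[set x | r x == k]|%:R = M (c + s y)%N k) ->
  rank_counts s (fun n k => M (c + n)%N (c + k)%N) ->
  rank_counts (osum_rank c r s) M.
Proof.
move=> ltrc rM M_low sM.
have inl_inj : injective (inl : P -> osum P Q) by move=> ? ? [].
have inr_inj : injective (inr : Q -> osum P Q) by move=> ? ? [].
have inlNinr (A : {set P}) (z : Q) : (inr z : osum P Q) \in inl @: A = false.
  by apply/negbTE/imsetP=> -[].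
have inrNinl (A : {set Q}) (z : P) : (inl z : osum P Q) \in inr @: A = false.
  by apply/negbTE/imsetP=> -[].
case=> [x|y] k.
  rewrite -[RHS]rM -(card_imset _ inl_inj); congr (_%:R).
  by apply: eq_card => -[z|z]; rewrite inE ?mem_imset ?inE ?le_inl.
have [ltkc|leck] := ltnP k c.
  rewrite -[RHS]M_low // -(card_imset _ inl_inj); congr (_%:R).
  apply: eq_card => -[z|z]; rewrite inE ?mem_imset ?inE ?le_inlr //.
  by rewrite inlNinr /= gtn_eqF ?andbF // ltn_addr.
rewrite /= -{2}(subnKC leck) -sM -(card_imset _ inr_inj); congr (_%:R).
apply: eq_card => -[z|z]; rewrite inE ?mem_imset ?inE ?le_inr //=.
  by rewrite inrNinl ltn_eqF ?andbF // (leq_trans (ltrc z)).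
by rewrite -[in LHS](subnKC leck) eqn_add2l.
Qed.

Lemma card_pdel d (P : finPOrderType d) (a : P) (A : pred P) : ~~ A a ->
  #|[set x : pdel a | A (val x)]| = #|[set x | A x]|.
Proof.
move=> Aa; rewrite -(card_imset _ val_inj); apply: eq_card => x; rewrite inE.
apply/imsetP/idP => [[y]|Ax]; first by rewrite inE => Ay ->.
have nxa : x != a by apply: contraNneq Aa => <-.
by exists (Sub x nxa); rewrite ?inE SubK.
Qed.

Lemma ranking_pdel_top d (P : finTPOrderType d) (r : P -> nat) :
  ranking r -> ranking (fun x : pdel (\top%O : P) => r (val x)).
Proof.
move=> [r_homo r_pred]; split=> [x y ltxy|x /r_pred[y ltyx rE]].
  by apply: r_homo; rewrite ltEsub in ltxy.
have ny : y != \top%O by apply: contraTneq ltyx => ->; rewrite le_gtF ?lex1.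
by exists (Sub y ny); rewrite ?ltEsub SubK.
Qed.

Lemma rank_counts_pdel_top d (P : finTPOrderType d) (r : P -> nat) M :
  rank_counts r M -> rank_counts (fun x : pdel (\top%O : P) => r (val x)) M.
Proof.
move=> rM x k; rewrite -rM.
rewrite -(@card_pdel _ _ \top%O (fun z => (z <= val x)%O && (r z == k))).
  by congr (_%:R); apply: eq_card => z; rewrite !inE leEsub.
by apply: contra (valP x) => /andP[letx _]; rewrite eq_le letx lex1.
Qed.

Lemma ranking_eq0 d (P : porderType d) (r : P -> nat) (b x : P) :
  is_least b -> ranking r -> (r x == 0%N) = (x == b).
Proof.
move=> b_least [r_homo r_pred]; have [->|nxb] := eqVneq x b.
  case: posnP => // /r_pred[y ltyb _].
  by rewrite (le_gtF (b_least y)) in ltyb.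
by rewrite eqn0Ngt (leq_ltn_trans _ (r_homo b x _)) // lt_def nxb b_least.
Qed.

Lemma ranking_bot d (Q : finBPOrderType d) (s : Q -> nat) y :
  ranking s -> (s y == 0%N) = (y == \bot%O).
Proof. by apply: ranking_eq0 => z; apply: le0x. Qed.

Lemma ranking_bot_gt0 d (Q : finBPOrderType d) (s : Q -> nat)
    (y : pdel (\bot%O : Q)) :
  ranking s -> (0 < s (val y))%N.
Proof. by move=> rs; rewrite lt0n (ranking_bot _ rs) (valP y). Qed.

Lemma ranking_pdel_bot d (Q : finBPOrderType d) (s : Q -> nat) :
  ranking s -> ranking (fun y : pdel (\bot%O : Q) => (s (val y)).-1).
Proof.
move=> rs; have [s_homo s_pred] := rs.
have s_eq0 y := ranking_bot y rs; have s_pos y := ranking_bot_gt0 y rs.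
split=> [x y|y sy0].
  by rewrite ltEsub => /s_homo lts; rewrite -ltnS !prednK.
have [|z ltzy sE] := s_pred (val y); first exact: s_pos.
have nz : z != \bot%O by rewrite -s_eq0 -lt0n; rewrite sE in sy0.
exists (Sub z nz); first by rewrite ltEsub SubK.
by rewrite SubK sE /= prednK // lt0n s_eq0.
Qed.

Lemma rank_counts_pdel_bot d (Q : finBPOrderType d) (s : Q -> nat) M :
  ranking s -> rank_counts s M ->
  rank_counts (fun y : pdel (\bot%O : Q) => (s (val y)).-1)
    (fun n k => M n.+1 k.+1).
Proof.
move=> rs sM y k.
have s_eq0 z := ranking_bot z rs; have s_pos z := ranking_bot_gt0 z rs.
rewrite prednK // -sM.
rewrite -(@card_pdel _ _ \bot%O (fun z => (z <= val y)%O && (s z == k.+1))).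
  congr (_%:R); apply: eq_card => z; rewrite !inE leEsub; congr (_ && _).
  by rewrite -[in RHS](prednK (s_pos z)) eqSS.
by have := s_eq0 \bot%O; rewrite eqxx => /eqP->; rewrite andbF.
Qed.

Lemma rank_counts_diag d (P : finPOrderType d) (r : P -> nat) M x :
  ranking r -> rank_counts r M -> M (r x) (r x) = 1.
Proof.
move=> [r_homo _] rM; rewrite -rM (_ : #|_| = 1%N) // -(cards1 x).
apply: eq_card => z; rewrite !inE.
apply/andP/eqP => [[]|->]; last by rewrite lexx eqxx.
by rewrite le_eqVlt => /orP[/eqP//|/r_homo lt /eqP eqr]; rewrite eqr ltnn in lt.
Qed.

Lemma rank_counts_col0 d (P : finPOrderType d) (r : P -> nat) M (b x : P) :
  is_least b -> ranking r -> rank_counts r M -> M (r x) 0%N = 1.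
Proof.
move=> b_least rr rM; rewrite -rM (_ : #|_| = 1%N) // -(cards1 b).
apply: eq_card => z; rewrite !inE (ranking_eq0 _ b_least rr).
by case: eqP => [->|]; rewrite ?b_least ?andbF.
Qed.

(** The two lemmas that follow distinguish whether P is reduced to its largest
    element; if it is, nothing of P remains in the sum. *)
Lemma least_osum d1 d2 (P : finTPOrderType d1) (Q : porderType d2) (a : P) :
  is_least a -> a != \top%O ->
  exists b : osum (pdel (\top%O : P)) Q, is_least b.
Proof.
move=> a_least na; exists (inl (Sub a na)) => -[x|y]; last exact: le_inlr.
by rewrite le_inl leEsub SubK.
Qed.

Lemma least_osum_inr d1 d2 (P : finTPOrderType d1) (Q : porderType d2) (b : Q) :
  is_least (\top%O : P) -> is_least b ->
  is_least (inr b : osum (pdel (\top%O : P)) Q).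
Proof.
move=> topl b_least [x|y]; last by rewrite le_inr.
by have := valP x; rewrite eq_le lex1 topl.
Qed.

Lemma pdel_top_max d (P : finTPOrderType d) (r : P -> nat) : ranking r ->
  (forall x : pdel (\top%O : P), r (val x) < r \top%O)%N /\
  ((0 < r \top%O)%N -> exists x : pdel (\top%O : P), r (val x) = (r \top%O).-1).
Proof.
move=> [r_homo r_pred]; split=> [x|/r_pred[y lty ->]].
  by apply: r_homo; rewrite lt_def eq_sym (valP x) lex1.
have ny : y != \top%O by rewrite (lt_eqF lty).
by exists (Sub y ny); rewrite SubK.
Qed.

Lemma card_pdel_top d (P : finTPOrderType d) (r : P -> nat) M k :
  rank_counts r M -> k != r \top%O ->
  #|[set x : pdel (\top%O : P) | r (val x) == k]|%:R = M (r \top%O) k.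
Proof.
move=> rM nk; rewrite -rM.
rewrite (@card_pdel _ _ \top%O (fun x => r x == k)) 1?eq_sym //.
by congr (_%:R); apply: eq_card => x; rewrite !inE lex1.
Qed.

Theorem corollary3p10 (d1 d2 : Order.disp_t)
    (P : finTPOrderType d1) (Q : finBPOrderType d2) :
  TN_poset P -> TN_poset Q ->
  [/\ TN_poset (osum P Q),
      TN_poset (osum (pdel (\top%O : P)) Q)
    & (1 < #|P|)%N \/ (exists b : pdel (\bot%O : Q), is_least b) ->
      TN_poset (osum (pdel (\top%O : P)) (pdel (\bot%O : Q)))].
Proof.
move=> /TN_poset_rank_array[a [r [A [N [a_least rr rA tA]]]]].
move=> [leN [x0 rx0] A_row A_tri].
move=> /TN_poset_rank_array[b [s [B [N' [b_least rs sB tB]]]]].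
move=> [_ _ B_row B_tri].
have {x0 rx0} NE : N = r \top%O.
  apply/eqP; rewrite eqn_leq leN andbT -rx0.
  have := lex1 x0; rewrite le_eqVlt => /orP[/eqP->//|].
  by case: rr => r_homo _ /r_homo/ltnW.
(* N is the rank of \top, whose row of A lists the level sizes of P. *)
subst N; set c := r \top%O in A_row leN *.
have [ltrc r_max] := pdel_top_max rr.
have Acc : A c c = 1 := rank_counts_diag _ rr rA.
have B0 y : B (s y) 0%N = 1 := rank_counts_col0 _ b_least rs sB.
have B_col n k : (N' < k)%N -> B n k = 0.
  by case: (ltnP N' n) => [/B_row->//|len ltk]; apply: B_tri; lia.
have rr' := ranking_pdel_top rr.
have tG : tn_array (array_glue c A B) by apply: tn_array_glue B_col _ _.
split.
(* P + Q is (P + 1) without its largest element, followed by Q: the array A is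
   extended to that of P + 1, and the gluing happens at rank c.+1. *)
- pose A' := array_extend c A.
  have A'E n k : (n <= c)%N -> A' n k = A n k.
    by move=> lenc; rewrite /A' /array_extend ltn_eqF.
  have A'c k : A' c.+1 k = A c k + (k == c.+1)%:R.
    by rewrite /A' /array_extend eqxx.
  have A'row n k : (c.+1 < n)%N -> A' n k = 0.
    by move=> ltcn; rewrite /A' /array_extend gtn_eqF // A_row //; lia.
  have A'tri n k : (n < k)%N -> A' n k = 0.
    move=> ltnk; case: (ltngtP n c.+1) => [len|ltcn|eqn].
    - by rewrite A'E // A_tri.
    - exact: A'row.
    - by rewrite eqn A'c A_tri ?gtn_eqF //; lia.
  have tA' : tn_array A' by apply: tn_array_extend.
  apply: (@TN_poset_of_rank_array _ (osum P Q) (inl a)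
    (osum_rank c.+1 r s) (array_glue c.+1 A' B)).
  + by case=> [x|y]; [rewrite le_inl | apply: le_inlr].
  + by apply: ranking_osum => // _; exists \top%O.
  + apply: rank_counts_osum => //.
    * by move=> x k; rewrite /array_glue ltnS leN A'E.
    * move=> y k ltk; rewrite /array_glue ltnNge leq_addr /= ltk addKn B0 mulr1.
      rewrite A'c ltn_eqF // addr0 -rA; congr (_%:R); apply: eq_card => z.
      by rewrite !inE lex1.
    * by move=> y k; rewrite sB /array_glue !ltnNge !leq_addr !addKn.
  + apply: (tn_array_glue (N := N')) => //.
    by rewrite A'c A_tri // eqxx add0r.
(* Removing \top frees rank c for the least element of Q, so A and B overlap
   in the entry (c, c). *)
- pose r' (x : pdel (\top%O : P)) := r (val x).
  have rr's : ranking (osum_rank c r' s) := ranking_osum rr' rs ltrc r_max.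
  have cM : rank_counts (osum_rank c r' s) (array_glue c A B).
    apply: rank_counts_osum => //.
    * by move=> x k; rewrite /array_glue ltrc (rank_counts_pdel_top rA).
    * move=> y k ltk; rewrite /array_glue ltnNge leq_addr /= ltk addKn B0 mulr1.
      by apply: card_pdel_top => //; rewrite ltn_eqF.
    * by move=> y k; rewrite sB /array_glue !ltnNge !leq_addr !addKn.
  have [atop|na] := eqVneq a \top%O; last first.
    have [b' b'_least] := least_osum Q a_least na.
    exact: (TN_poset_of_rank_array b'_least rr's cM tG).
  rewrite atop in a_least.
  exact: (TN_poset_of_rank_array (least_osum_inr a_least b_least) rr's cM tG).
(* The least element of Q was the only one of rank c, so the array of the third
   poset is the glued array without its row and column c. *)
move=> least.
have [b' b'_least] :
    exists b : osum (pdel (\top%O : P)) (pdel (\bot%O : Q)), is_least b.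
  have [atop|na] := eqVneq a \top%O; last exact: least_osum a_least na.
  rewrite atop in a_least.
  case: least => [/card_gt1P[x [y [_ _ /eqP[]]]]|[b' b'_least]]; last first.
    by exists (inr b'); apply: least_osum_inr.
  have eq_top (z : P) : z = \top%O by apply/eqP; rewrite eq_le lex1 a_least.
  by rewrite (eq_top x) (eq_top y).
have s_pos y := ranking_bot_gt0 y rs.
have bump_low n : (n < c)%N -> bump c n = n by rewrite /bump ltnNge => /negPf->.
have bump_high n : (c <= n)%N -> bump c n = n.+1 by rewrite /bump => ->.
have tG' : tn_array (fun n k => array_glue c A B (bump c n) (bump c k)).
  by apply: tn_array_comp tG => n m; rewrite /bump; lia.
apply: (TN_poset_of_rank_array b'_least _ _ tG').
  exact: (ranking_osum rr' (ranking_pdel_bot rs)).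
apply: rank_counts_osum => //.
* move=> x k; rewrite (rank_counts_pdel_top rA) bump_low // /array_glue ltrc.
  case: (ltnP k c) => [ltkc|leck]; first by rewrite bump_low.
  have ltxk : (r (val x) < k)%N := leq_trans (ltrc x) leck.
  by rewrite bump_high // !A_tri // ltnW.
* move=> y k ltk; rewrite bump_high ?leq_addr // -addnS prednK // bump_low //.
  rewrite /array_glue ltnNge leq_addr /= ltk addKn B0 mulr1.
  by apply: card_pdel_top => //; rewrite ltn_eqF.
* move=> y k; rewrite (rank_counts_pdel_bot rs sB) /array_glue.
  rewrite !bump_high ?leq_addr // !ltnNge !leqW ?leq_addr //=.
  by rewrite !subSn ?leq_addr // !addKn.
Qed.
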